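(* Let $n\ge 1$. If $X$ is a connected, locally $n$-connected separable metric space and $x\in X$, then the homotopy group $\pi_n(X,x)$ is countable.
   Context: A space $X$ is called locally $n$-connected if for each $x\in X$ and each neighborhood $U$ of $x$ there is a neighborhood $V\subseteq U$ of $x$ such that the map $\pi_k(V)\to\pi_k(U)$ induced by inclusion is the zero (trivial) map for all $0\le k\le n$ and for all base points in $V$ (for $k=0$: any two points of $V$ lie in the same path component of $U$). *)

(* Defs.v *)
From mathcomp Require Import all_boot all_order all_algebra.
From mathcomp Require Import all_classical all_reals.
From mathcomp Require Import topology normedtype.

Set Implicit Arguments.
Unset Strict Implicit.
Unset Printing Implicit Defensive.

Import Order.TTheory GRing.Theory Num.Theory.
Import numFieldNormedType.Exports.

Local Open Scope classical_set_scope.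
Local Open Scope ring_scope.

Definition separable (T : topologicalType) : Prop :=
  exists2 S : set T, countable S & dense S.

Definition cube (R : realType) (n : nat) : set 'rV[R]_n :=
  [set t | forall i, 0 <= t ord0 i <= 1].

(* For n = 0 the cube is a point and its boundary is empty. *)
Definition cube_boundary (R : realType) (n : nat) : set 'rV[R]_n :=
  [set t | cube t /\ exists i, t ord0 i = 0 \/ t ord0 i = 1].

(* Maps of pairs (I^n, dI^n) -> (T, x) are represented by functions on R^n, of
   which only the values on the cube are ever used. *)
Definition sphere_map (R : realType) (n : nat) (T : topologicalType) (x : T)
    : set ('rV[R]_n -> T) :=
  [set f | {within @cube R n, continuous f} /\
           forall t, cube_boundary t -> f t = x].

(* Homotopy through maps of pairs (I^n, dI^n) -> (T, x); it forces f and g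
   themselves to be such maps. *)
Definition homotopic (R : realType) (n : nat) (T : topologicalType) (x : T)
    (f g : 'rV[R]_n -> T) : Prop :=
  exists H : R * 'rV[R]_n -> T,
    [/\ {within `[0%R, 1%R]%classic `*` @cube R n, continuous H},
        forall t, cube t -> H (0, t) = f t,
        forall t, cube t -> H (1, t) = g t &
        forall s t, 0 <= s <= 1 -> cube_boundary t -> H (s, t) = x].

Definition homotopy_class (R : realType) (n : nat) (T : topologicalType)
    (x : T) (f : 'rV[R]_n -> T) : set ('rV[R]_n -> T) :=
  [set g | homotopic x f g].

(* The underlying set of pi_n(T, x), as a set of homotopy classes; for n = 0,
   where the boundary of the cube is empty, it is the set of path components
   of T. *)
Definition homotopy_group (R : realType) (n : nat) (T : topologicalType)
    (x : T) : set (set ('rV[R]_n -> T)) :=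
  [set homotopy_class x f | f in @sphere_map R n T x].

(* phi_*[f] = [phi \o f], written independently of the representative f *)
Definition induced_map (R : realType) (n : nat) (T T' : topologicalType)
    (phi : T -> T') (x : T) (c : set ('rV[R]_n -> T)) : set ('rV[R]_n -> T') :=
  \bigcup_(f in c) homotopy_class (phi x) (phi \o f).

(* For n = 0, requiring this at every x says that phi maps any two points of T
   to the same path component of T'. *)
Definition induced_map_trivial (R : realType) (n : nat)
    (T T' : topologicalType) (phi : T -> T') (x : T) : Prop :=
  forall c, @homotopy_group R n T x c ->
    induced_map phi x c = homotopy_class (phi x) (cst (phi x)).

Definition inclusion (T : Type) (V U : set T) (VU : V `<=` U)
    (v : set_type V) : set_type U :=
  exist _ (set_val v) (mem_set (VU _ (set_valP v))).

(* Subsets carry the subspace topology that the library puts on set_type. *)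
Definition locally_n_connected (R : realType) (n : nat) (X : topologicalType)
    : Prop :=
  forall (x : X) (U : set X), nbhs x U ->
    exists (V : set X) (VU : V `<=` U), nbhs x V /\
      forall k, (k <= n)%N -> forall v : set_type V,
        @induced_map_trivial R k (set_type V) (set_type U) (inclusion VU) v.

(* Main.v *)
Require Import Defs.
From mathcomp Require Import all_boot all_order all_algebra.
From mathcomp Require Import all_classical all_reals.
From mathcomp Require Import topology normedtype.
From mathcomp Require Import lra.

(** A locally n-connected space has the following rigidity: if two maps
    (I^n, dI^n) -> (X, x) are uniformly close enough, then they are homotopic
    relative to dI^n ([close_homotopic]).  The homotopy class is therefore a
    locally constant function on the set of such maps with the topology of
    uniform convergence.  As X is separable and the cube is compact, that set
    of maps is separable too, so a locally constant function on it takes only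
    countably many values ([countable_locally_constant]).

    The homotopy between close maps f and g is a filling problem in R^(n+1):
    f on the bottom face, g on the top face and x on the other faces form a map
    on the boundary of the cube I x I^n which is close to F(s, t) = f(t), and it
    has to be extended over the cube.  Three steps achieve this.

    - A map from the boundary of a box of dimension k + 1 into V extends to a
      map from the box into U as soon as pi_k(V) -> pi_k(U) is trivial
      ([disk_filling], [box_filling]).  This requires passing from maps on a
      cube that collapse the boundary, by which homotopy groups are defined, to
      maps on the boundary of a cube; an explicit retraction of the collar
      1/2 <= |p| <= 1 onto the sphere |p| = 1 does it.

    - Consequently, over boxes so small that F is almost constant on them, every
      boundary map close to F has an extension close to F; compactness of the
      cube makes the constants uniform ([small_box_filling]).

    - The width restrictions are removed one coordinate at a time
      ([controlled_filling]).  A box that is wide in direction j is cut into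
      slabs by hyperplanes p_j = s.  Each slice is a box of width 0 in direction
      j, so the map can first be extended over the slices and then over the
      slabs, whose boundaries consist of slices and of pieces of the boundary of
      the whole box.  Since degenerate boxes are boxes of lower dimension, no
      skeleta of cell complexes need to be handled. *)

Set Implicit Arguments.
Unset Strict Implicit.
Unset Printing Implicit Defensive.

Import Order.TTheory GRing.Theory Num.Theory.
Import numFieldNormedType.Exports.

Local Open Scope classical_set_scope.
Local Open Scope ring_scope.

(** * Continuity on subsets and rows of reals *)

Lemma within_comp (T U W : topologicalType) (A : set T) (B : set U)
    (f : T -> U) (g : U -> W) :
  (forall x, A x -> B (f x)) -> {within A, continuous f} ->
  {within B, continuous g} -> {within A, continuous (g \o f)}.
Proof.
move=> fAB /subspace_continuousP cf /subspace_continuousP cg.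
apply/subspace_continuousP => x Ax S /(cg _ (fAB _ Ax)) /(cf _ Ax).
rewrite /nbhs/= /within/= => h.
by apply: filterS h => y hy Ay; apply: hy => //; apply: fAB.
Qed.

Lemma within_eq (T U : topologicalType) (A : set T) (f g : T -> U) :
  (forall x, A x -> f x = g x) -> {within A, continuous f} ->
  {within A, continuous g}.
Proof.
by move=> fg; apply: subspace_eq_continuous => x; rewrite inE; apply: fg.
Qed.

Lemma within_subtype (T X : topologicalType) (V : set X) (A : set T)
    (f : T -> set_type V) :
  {within A, continuous (set_val \o f)} -> {within A, continuous f}.
Proof. by move=> cf; apply: continuous_comp_initial; exact: cf. Qed.

Lemma continuous_row (T U : topologicalType) (n : nat) (f : T -> 'rV[U]_n) :
  (forall i, continuous (fun x => f x ord0 i)) -> continuous f.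
Proof.
move=> cf x S [P nP PS]; apply: (filterS PS).
suff : \forall y \near x, forall i j, P i j (f y i j) by [].
apply: filter_forall => i; apply: filter_forall => j.
by rewrite ord1; apply: cf; exact: (nP ord0 j).
Qed.

Section RealContinuity.
Context {R : realType} {T : topologicalType}.
Implicit Types f g : T -> R.

Lemma continuous_add f g : continuous f -> continuous g ->
  continuous (fun x => f x + g x).
Proof. by move=> cf cg x; apply: cvgD; [exact: cf|exact: cg]. Qed.

Lemma continuous_sub f g : continuous f -> continuous g ->
  continuous (fun x => f x - g x).
Proof. by move=> cf cg x; apply: cvgB; [exact: cf|exact: cg]. Qed.

Lemma continuous_mul f g : continuous f -> continuous g ->
  continuous (fun x => f x * g x).
Proof. by move=> cf cg x; apply: cvgM; [exact: cf|exact: cg]. Qed.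

Lemma continuous_maxr f g : continuous f -> continuous g ->
  continuous (fun x => Num.max (f x) (g x)).
Proof. by move=> cf cg x; apply: continuous_max; [exact: cf|exact: cg]. Qed.

Lemma within_normalize n (f : T -> 'rV[R]_n) (A : set T) :
  continuous f -> (forall x, A x -> f x != 0) ->
  {within A, continuous (fun x => `|f x|^-1 *: f x)}.
Proof.
move=> cf f0; apply: continuous_in_subspaceT => x; rewrite inE => /f0 fx0.
apply: cvgZ; last exact: cf.
apply: cvgV; first by rewrite normr_eq0.
by apply: cvg_norm; exact: cf.
Qed.

End RealContinuity.

Lemma continuous_pair (T U W : topologicalType) (f : T -> U) (g : T -> W) :
  continuous f -> continuous g -> continuous (fun x => (f x, g x)).
Proof. by move=> cf cg x; apply: cvg_pair; [exact: cf|exact: cg]. Qed.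

Section ClosedConditions.
Context {R : realType} {T : topologicalType}.
Implicit Types f : T -> R.

Lemma closed_sub_le f c : continuous f -> closed [set x | f x <= c].
Proof. by move=> /continuous_closedP /(_ _ (@closed_le _ c)). Qed.

Lemma closed_sub_ge f c : continuous f -> closed [set x | c <= f x].
Proof. by move=> /continuous_closedP /(_ _ (@closed_ge _ c)). Qed.

Lemma closed_sub_eq f c : continuous f -> closed [set x | f x = c].
Proof. by move=> /continuous_closedP /(_ _ (@closed_eq _ c)). Qed.

End ClosedConditions.

Lemma unit_itvP (R : realType) (s : R) :
  `[0, 1]%classic s <-> 0 <= s <= 1.
Proof. by rewrite /= in_itv. Qed.

Lemma closed_preimage (T U : topologicalType) (f : T -> U) (A : set U) :
  continuous f -> closed A -> closed (f @^-1` A).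
Proof. by move=> /continuous_closedP; apply. Qed.

Section Rows.
Context {R : realType}.

Lemma row_norm_le n (p : 'rV[R]_n) (c : R) :
  0 <= c -> `|p| <= c <-> forall i, `|p ord0 i| <= c.
Proof.
move=> c0; have -> : `|p| = mx_norm p by [].
rewrite mx_normrE; split.
  move=> /bigmax_leP[_ h] i; exact: (h (ord0, i)).
by move=> h; apply/bigmax_leP; split=> // -[i j] _ /=; rewrite ord1.
Qed.

Lemma row_norm_ge n (p : 'rV[R]_n) i : `|p ord0 i| <= `|p|.
Proof. by have /row_norm_le := lexx `|p|; apply. Qed.

Lemma row_norm_attained n (p : 'rV[R]_n) :
  `|p| != 0 -> exists i, `|p ord0 i| = `|p|.
Proof.
by move=> /mx_norm_neq0[[i j] /=]; rewrite (ord1 i) => e; exists j; exact/esym.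
Qed.

Definition cons_row n (h : R) (u : 'rV[R]_n) : 'rV[R]_n.+1 :=
  \row_i (if unlift ord0 i is Some j then u ord0 j else h).

Definition tail_row n (p : 'rV[R]_n.+1) : 'rV[R]_n :=
  \row_j p ord0 (lift ord0 j).

Lemma cons_row0 n h (u : 'rV[R]_n) : cons_row h u ord0 ord0 = h.
Proof. by rewrite mxE unlift_none. Qed.

Lemma cons_rowS n h (u : 'rV[R]_n) j :
  cons_row h u ord0 (lift ord0 j) = u ord0 j.
Proof. by rewrite mxE liftK. Qed.

Lemma cons_rowK n h (u : 'rV[R]_n) : tail_row (cons_row h u) = u.
Proof. by apply/rowP => j; rewrite mxE cons_rowS. Qed.

Lemma tail_rowK n (p : 'rV[R]_n.+1) : cons_row (p ord0 ord0) (tail_row p) = p.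
Proof.
by apply/rowP => i; rewrite mxE; case: unliftP => [j ->|->//]; rewrite mxE.
Qed.

Lemma continuous_tail_row n : continuous (@tail_row n).
Proof.
apply: continuous_row => i.
under eq_fun do rewrite mxE.
exact: coord_continuous.
Qed.

Lemma cons_row_norm_le n h (u : 'rV[R]_n) c :
  `|cons_row h u| <= c <-> `|h| <= c /\ `|u| <= c.
Proof.
split=> [le_c|[hc uc]].
  have c0 : 0 <= c by apply: le_trans le_c.
  have /row_norm_le := le_c => /(_ c0) le_ci.
  split; first by have := le_ci ord0; rewrite cons_row0.
  by apply/row_norm_le => // i; have := le_ci (lift ord0 i); rewrite cons_rowS.
have c0 : 0 <= c by apply: le_trans uc.
apply/row_norm_le => // i; rewrite mxE; case: unliftP => [j _|_ //].
exact: le_trans (row_norm_ge _ _) uc.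
Qed.

Lemma tail_row_norm n (p : 'rV[R]_n.+1) : `|tail_row p| <= `|p|.
Proof.
by have /cons_row_norm_le[] : `|cons_row (p ord0 ord0) (tail_row p)| <= `|p|
  by rewrite tail_rowK.
Qed.

End Rows.

(** * Trivial induced maps *)

Lemma homotopic_refl (R : realType) (n : nat) (T : topologicalType) (x : T)
    (f : 'rV[R]_n -> T) : sphere_map x f -> homotopic x f f.
Proof.
move=> [cf fx]; exists (fun st => f st.2); split => //.
  apply: (within_comp (B := @cube R n)) cf; first by move=> st [].
  by apply: continuous_subspaceT => st; exact: cvg_snd.
by move=> s t _ /fx.
Qed.

(** Triviality of the induced map is an equality of sets of maps; evaluated at
    the representative f itself it gives the null-homotopy. *)
Lemma induced_map_trivial_null (R : realType) (n : nat)
    (T T' : topologicalType) (phi : T -> T') (x : T) (f : 'rV[R]_n -> T) :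
  continuous phi -> @induced_map_trivial R n T T' phi x -> sphere_map x f ->
  homotopic (phi x) (cst (phi x)) (phi \o f).
Proof.
move=> cphi triv sf.
have /triv /seteqP[sub _] : homotopy_group x (homotopy_class x f) by exists f.
apply: sub; exists f; first exact: homotopic_refl.
apply: homotopic_refl; case: sf => cf fx; split.
  apply: (within_comp (B := setT)) cf _ => //.
  exact: continuous_subspaceT.
by move=> t /fx /= ->.
Qed.

Lemma inclusion_continuous (X : topologicalType) (V U : set X) (VU : V `<=` U) :
  continuous (inclusion VU).
Proof.
apply: continuous_comp_initial.
have -> : set_val \o inclusion VU = set_val by apply/funext.
exact: initial_continuous.
Qed.

(** * Retraction of the collar of a cube onto its boundary *)

(** The cube is the unit ball of the maximum norm on rows p = (h, u), with the
    height h in coordinate 0.  [collar_retract] maps the collar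
    1/2 <= |p| <= 1 to the sphere |p| = 1.  It is the identity on the outer
    sphere and sends every face of the inner cube other than the top one to the
    single point [south].  Thus a map phi on the outer sphere becomes, on the
    top face of the inner cube, a map that is constant on the boundary of that
    face, as the maps that represent elements of homotopy groups are. *)
Section Collar.
Context {R : realType} {m : nat}.
Implicit Type p : 'rV[R]_m.+1.

Lemma row_norm_cases p :
  [/\ `|p ord0 ord0| <= `|p|, `|tail_row p| <= `|p| &
      `|p ord0 ord0| = `|p| \/ `|tail_row p| = `|p|].
Proof.
have h := row_norm_ge p ord0; have u := tail_row_norm p; split=> //.
have [c|c] := leP `|p ord0 ord0| `|tail_row p|.
  right; apply/eqP; rewrite eq_le u /= -{1}(tail_rowK p).
  by apply/cons_row_norm_le; split.
left; apply/eqP; rewrite eq_le h /= -{1}(tail_rowK p).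
by apply/cons_row_norm_le; split => //; exact: ltW.
Qed.

(** 0 on the inner sphere and 1 on the outer one: the parameter along which
    [collar_map] is interpolated. *)
Definition collar_tau p : R := 2 * `|p| - 1.

(** The height of the image.  The value h/2 - |u| used on the inner sphere is
    negative outside the top face and positive at the centre of that face. *)
Definition collar_ell p : R :=
  (1 - collar_tau p) * (p ord0 ord0 / 2 - `|tail_row p|)
  + collar_tau p * p ord0 ord0.

(** The factor by which u is scaled.  The value max(0, h - |u|) used on the
    inner sphere vanishes exactly outside the interior of the top face. *)
Definition collar_chi p : R :=
  collar_tau p
  + (1 - collar_tau p) * Num.max 0 (p ord0 ord0 - `|tail_row p|).

Definition collar_map p : 'rV[R]_m.+1 :=
  cons_row (collar_ell p) (collar_chi p *: tail_row p).

Definition collar_retract p : 'rV[R]_m.+1 :=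
  `|collar_map p|^-1 *: collar_map p.

Definition south : 'rV[R]_m.+1 := cons_row (-1) 0.

Lemma south_norm : `|south| = 1.
Proof.
apply/eqP; rewrite eq_le; apply/andP; split.
  by apply/cons_row_norm_le; rewrite normrN1 normr0; split=> //; exact: ler01.
by have := row_norm_ge south ord0; rewrite cons_row0 normrN1.
Qed.

(** On the inner sphere, the factor of u vanishes only where the height is
    negative, and for u = 0 the height is h/2, where |h| = 1/2; off the inner
    sphere the factor is positive, and for u = 0 the height is a positive
    multiple of h, which is then nonzero. *)
Lemma collar_map_neq0 p : 1 / 2 <= `|p| <= 1 -> collar_map p != 0.
Proof.
move=> /andP[p_ge p_le]; apply/eqP => L0.
have ell0 : collar_ell p = 0.
  by have := congr1 (fun q : 'rV__ => q ord0 ord0) L0; rewrite cons_row0 mxE.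
have /eqP : `|collar_chi p *: tail_row p| = 0.
  by have := congr1 (fun q => `|tail_row q|) L0; rewrite cons_rowK => ->;
    rewrite (_ : tail_row 0 = 0) ?normr0//; apply/rowP => j; rewrite !mxE.
have [hp up hu] := row_norm_cases p.
rewrite normrZ mulf_eq0 !normr_eq0 => chiu.
move: ell0 chiu {L0}; rewrite -(normr_eq0 (tail_row p)).
rewrite /collar_ell /collar_chi /collar_tau.
move: hp up hu p_ge p_le; set r := `|p|; set w := `|tail_row p|.
have w0 : 0 <= w by exact: normr_ge0.
set h : R := p ord0 ord0 => hp up hu p_ge p_le ell0 /orP[] /eqP e0.
  have mx0 : 0 <= Num.max 0 (h - w) by rewrite le_max lexx.
  have mx1 : h - w <= Num.max 0 (h - w) by rewrite le_max lexx orbT.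
  have m0 : 0 <= (1 - (2 * r - 1)) * Num.max 0 (h - w) by nra.
  have r2 : r = 1/2 by nra.
  have hw : h <= w by rewrite r2 in e0; nra.
  have w00 : w = 0 by rewrite r2 in ell0; lra.
  have h00 : h = 0 by rewrite r2 in ell0; lra.
  by move: hu; rewrite h00 w00 normr0 r2 => -[]; lra.
case: hu => hr; last by lra.
rewrite e0 in ell0.
have /eqP : h * r = 0 by lra.
rewrite mulf_eq0 => /orP[] /eqP; last by lra.
by move=> h00; move: hr; rewrite h00 normr0; lra.
Qed.

Lemma collar_retract_norm p : 1 / 2 <= `|p| <= 1 -> `|collar_retract p| = 1.
Proof.
move=> /collar_map_neq0 L0.
by rewrite normrZ normfV normr_id mulVf// normr_eq0.
Qed.

Lemma collar_retract_outer p : `|p| = 1 -> collar_retract p = p.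
Proof.
move=> p1; have L : collar_map p = p.
  rewrite /collar_map /collar_ell /collar_chi /collar_tau p1.
  rewrite -[RHS]tail_rowK; congr cons_row; first by lra.
  by rewrite (_ : 2 * 1 - 1 = 1 :> R) ?subrr ?mul0r ?addr0 ?scale1r//; lra.
by rewrite /collar_retract L p1 invr1 scale1r.
Qed.

(** On these faces the factor of u vanishes and the height is negative, so the
    image lies on the ray through [south], which normalization contracts to a
    point. *)
Lemma collar_retract_inner p :
  `|p| = 1 / 2 -> p ord0 ord0 = - (1 / 2) \/ `|tail_row p| = 1 / 2 ->
  collar_retract p = south.
Proof.
move=> p2 J; have [hp up _] := row_norm_cases p; rewrite p2 in hp up.
have h1 : p ord0 ord0 <= `|tail_row p|.
  by move: J => [->|->]; [apply: le_trans (normr_ge0 _); lra|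
    exact: le_trans (ler_norm _) hp].
have chi0 : collar_chi p = 0.
  rewrite /collar_chi /collar_tau p2 max_l; lra.
have ell0 : collar_ell p < 0.
  have := normr_ge0 (tail_row p); have := le_trans (ler_norm _) hp.
  rewrite /collar_ell /collar_tau p2.
  by case: J => [->|->]; lra.
have L : collar_map p = - collar_ell p *: south.
  rewrite /collar_map chi0 scale0r; apply/rowP => i; rewrite !mxE.
  by case: unliftP => [j _|_]; rewrite ?mxE ?mulr0// mulrN1 opprK.
rewrite /collar_retract L normrZ.
rewrite south_norm mulr1 gtr0_norm ?oppr_gt0// scalerA mulVf ?scale1r//.
by rewrite oppr_eq0 lt_eqF.
Qed.

Lemma continuous_collar_map : continuous collar_map.
Proof.
have cn : continuous (fun p : 'rV[R]_m.+1 => `|p|) by exact: norm_continuous.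
have cu : continuous (fun p : 'rV[R]_m.+1 => `|tail_row p|).
  move=> p; apply: continuous_comp; last exact: norm_continuous.
  exact: continuous_tail_row.
have ch : continuous (fun p : 'rV[R]_m.+1 => p ord0 ord0) by exact: coord_continuous.
have ct : continuous collar_tau.
  apply: continuous_sub; last exact: cst_continuous.
  by apply: continuous_mul => //; exact: cst_continuous.
have cell : continuous collar_ell.
  apply: continuous_add; last exact: continuous_mul.
  apply: continuous_mul; first by apply: continuous_sub => //; exact: cst_continuous.
  apply: continuous_sub => //.
  by apply: continuous_mul => //; exact: cst_continuous.
have cchi : continuous collar_chi.
  apply: continuous_add => //; apply: continuous_mul.
    by apply: continuous_sub => //; exact: cst_continuous.
  apply: continuous_maxr; first exact: cst_continuous.
  exact: continuous_sub.
apply: continuous_row => i; case: (unliftP ord0 i) => [j ->|->].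
  under eq_fun do rewrite cons_rowS 2!mxE.
  by apply: continuous_mul => //; exact: coord_continuous.
by under eq_fun do rewrite cons_row0.
Qed.

Lemma within_collar_retract :
  {within [set p | 1 / 2 <= `|p| <= 1], continuous collar_retract}.
Proof.
apply: within_normalize; first exact: continuous_collar_map.
by move=> p; exact: collar_map_neq0.
Qed.

End Collar.

(** * Filling the boundary of a box *)

(** The collar 1/2 <= |p| <= 1 is filled by phi composed with the collar
    retraction, which takes its values in V.  On the top face of the inner cube
    this is a map into V that is constant on the boundary, and it is constant on
    the other faces.  A null-homotopy of that map in U, with the height as time, fills the inner cube. *)
Lemma disk_filling (R : realType) (m : nat) (X : topologicalType)
    (V U : set X) (VU : V `<=` U) (phi : 'rV[R]_m.+1 -> X) :
  (forall v, @induced_map_trivial R m _ _ (inclusion VU) v) ->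
  {within [set p | `|p| = 1], continuous phi} ->
  (forall p, `|p| = 1 -> V (phi p)) ->
  exists Phi : 'rV[R]_m.+1 -> X,
    [/\ {within [set p | `|p| <= 1], continuous Phi},
        forall p, `|p| = 1 -> Phi p = phi p &
        forall p, `|p| <= 1 -> U (Phi p)].
Proof.
move=> triv cphi Vphi.
pose half : 'rV[R]_m := const_mx (1 / 2).
pose v : set_type V := exist _ (phi south) (mem_set (Vphi _ south_norm)).
pose top (t : 'rV[R]_m) : 'rV[R]_m.+1 := cons_row (1 / 2) (t - half).
have cube_norm t : cube t <-> `|t - half| <= 1 / 2.
  rewrite row_norm_le; last by lra.
  by split=> h i; have := h i; rewrite !mxE ler_norml => /andP[? ?];
    apply/andP; split; lra.
have half_ge0 : 0 <= 1 / 2 :> R by lra.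
have top_norm t : cube t -> `|top t| = 1 / 2.
  move=> /cube_norm t2; apply/eqP; rewrite eq_le; apply/andP; split.
    by apply/cons_row_norm_le; rewrite ger0_norm.
  have := row_norm_ge (top t) ord0; rewrite cons_row0 ger0_norm//.
have half_in : 1 / 2 <= (1 / 2 : R) <= 1 by apply/andP; split; lra.
have Vloop t : cube t -> V (phi (collar_retract (top t))).
  by move=> /top_norm t2; apply: (Vphi); apply: collar_retract_norm; rewrite t2.
(* Outside the cube the formula may leave V; v is a default value there. *)
pose loop (t : 'rV[R]_m) : set_type V :=
  if pselect (V (phi (collar_retract (top t)))) is left w
  then exist (fun x => x \in V) _ (mem_set w) else v.
have loopE t : cube t -> set_val (loop t) = phi (collar_retract (top t)).
  by move=> /Vloop Vt; rewrite /loop; case: pselect.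
have edge_norm t : cube_boundary t -> `|t - half| = 1 / 2.
  move=> [/cube_norm t2 [i ti]]; apply/eqP; rewrite eq_le t2 /=.
  apply: le_trans (row_norm_ge _ i); rewrite !mxE.
  by case: ti => ->; rewrite ler_normr; apply/orP; [right|left]; lra.
have ctop : continuous top.
  apply: continuous_row => i; case: (unliftP ord0 i) => [j ->|->].
    under eq_fun do rewrite cons_rowS 2!mxE.
    by apply: continuous_add; [exact: coord_continuous|exact: cst_continuous].
  by under eq_fun do rewrite cons_row0; exact: cst_continuous.
have sloop : sphere_map v loop.
  split.
    apply: within_subtype; apply: (within_eq (f := phi \o (collar_retract \o top))).
      by move=> t /loopE.
    apply: (within_comp (B := [set p | `|p| = 1])) cphi.
      by move=> t /top_norm t2; apply: collar_retract_norm; rewrite t2.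
    apply: within_comp within_collar_retract.
      by move=> t /top_norm t2 /=; rewrite t2.
    exact: continuous_subspaceT.
  move=> t dt; apply: val_inj; have [ct _] := dt.
  change (set_val (loop t) = phi south); rewrite loopE//.
  rewrite collar_retract_inner//; first exact: top_norm.
  by right; rewrite cons_rowK; exact: edge_norm.
have [H [cH H0 H1 Hd]] :=
  induced_map_trivial_null (@inclusion_continuous _ _ _ VU) (triv v) sloop.
pose shift (p : 'rV[R]_m.+1) : R * 'rV[R]_m :=
  (p ord0 ord0 + 1 / 2, tail_row p + half).
pose Phi p := if `|p| <= 1 / 2 then set_val (H (shift p))
              else phi (collar_retract p).
(* Both definitions of Phi agree on the inner sphere, where they meet: on the
   bottom face at time 0, on the lateral faces and on the top face at time 1. *)
have collarE p : 1 / 2 <= `|p| -> Phi p = phi (collar_retract p).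
  move=> p_ge; rewrite /Phi; case: ifPn => // p_le.
  have p2 : `|p| = 1 / 2 by apply/eqP; rewrite eq_le p_le.
  have [hp up hu] := row_norm_cases p; rewrite p2 in hp up hu.
  have hp' : 0 <= p ord0 ord0 + 1 / 2 <= 1.
    by move: hp; rewrite ler_norml => /andP[? ?]; apply/andP; split; lra.
  have cp : cube (tail_row p + half) by apply/cube_norm; rewrite addrK.
  have [pm|pm] := eqVneq (p ord0 ord0) (- (1 / 2)).
    rewrite collar_retract_inner//; last by left.
    have := H0 _ cp; rewrite /shift pm addNr => -> //.
  have [pt|pt] := eqVneq (`|tail_row p|) (1 / 2).
    rewrite collar_retract_inner//; last by right.
    rewrite /shift Hd//; split => //.
    have [|i] := row_norm_attained (p := tail_row p).
      by rewrite pt; apply/eqP; lra.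
    rewrite pt => ei; exists i; rewrite [(_ + half) _ _]mxE [half _ _]mxE.
    have := ei; have [s|s] := leP 0 (tail_row p ord0 i).
      by rewrite ger0_norm// => ->; right; lra.
    by rewrite ltr0_norm// => e; left; lra.
  have pe : p ord0 ord0 = 1 / 2.
    case: hu; last by move/eqP; rewrite (negbTE pt).
    have [s|s] := leP 0 (p ord0 ord0); first by rewrite ger0_norm.
    by rewrite ltr0_norm// => e; move/eqP: pm => []; lra.
  have -> : shift p = (1, tail_row p + half) by rewrite /shift pe; congr pair; lra.
  rewrite H1//.
  change (set_val (loop (tail_row p + half)) = phi (collar_retract p)).
  by rewrite loopE// /top addrK -pe tail_rowK.
have cshift : continuous (fun p : 'rV[R]_m.+1 => tail_row p + half).
  apply: continuous_row => i; under eq_fun do rewrite 3!mxE.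
  by apply: continuous_add; [exact: coord_continuous|exact: cst_continuous].
exists Phi; split.
- have -> : [set p : 'rV[R]_m.+1 | `|p| <= 1] =
      [set p | `|p| <= 1 / 2] `|` [set p | 1 / 2 <= `|p| <= 1].
    apply/seteqP; split=> [p /= p1|p /=].
      by have [|/ltW] := leP `|p| (1 / 2); [left|right; apply/andP].
    by case=> [|/andP[]//] p2; apply: le_trans p2 _; lra.
  apply: withinU_continuous.
  + by apply: closed_sub_le; exact: norm_continuous.
  + have -> : [set p : 'rV[R]_m.+1 | 1 / 2 <= `|p| <= 1] =
        [set p | 1 / 2 <= `|p|] `&` [set p | `|p| <= 1].
      by apply/seteqP; split=> p /= /andP.
    by apply: closedI; [apply: closed_sub_ge|apply: closed_sub_le];
      exact: norm_continuous.
  + apply: (within_eq (f := set_val \o (H \o shift))).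
      by move=> p /= p2; rewrite /Phi p2.
    apply: (within_comp (B := setT)) => //; last first.
      by apply: continuous_subspaceT; exact: initial_continuous.
    apply: within_comp cH.
      move=> p /= p2; have [hp up _] := row_norm_cases p; split => /=.
        have := le_trans hp p2; rewrite in_itv/= ler_norml => /andP[? ?].
        by apply/andP; split; lra.
      by apply/cube_norm; rewrite addrK (le_trans up).
    apply/continuous_subspaceT/continuous_pair; last exact: cshift.
    by apply: continuous_add; [exact: coord_continuous|exact: cst_continuous].
  + apply: (within_eq (f := phi \o collar_retract)).
      by move=> p /andP[/collarE ->].
    apply: within_comp within_collar_retract cphi => p.
    exact: collar_retract_norm.
- move=> p p1; rewrite collarE ?collar_retract_outer// p1.
  by lra.
- move=> p p1; have [p2|/ltW p2] := leP `|p| (1 / 2).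
    by rewrite /Phi p2; exact: set_valP.
  by rewrite collarE//; apply/VU/Vphi/collar_retract_norm; rewrite p2.
Qed.

Section Boxes.
Context {R : realType} {N : nat}.
Implicit Types a b p : 'rV[R]_N.

Definition box a b : set 'rV[R]_N :=
  [set p | forall i, a ord0 i <= p ord0 i <= b ord0 i].

(** The faces that count are those in the directions in which the box has
    positive width, so that a degenerate box, such as a face or a slice of
    another box, comes with its boundary as a box of lower dimension. *)
Definition box_boundary a b : set 'rV[R]_N :=
  [set p | box a b p /\ exists i, a ord0 i < b ord0 i /\
             (p ord0 i = a ord0 i \/ p ord0 i = b ord0 i)].

Lemma box_boundary_sub a b : box_boundary a b `<=` box a b.
Proof. by move=> p []. Qed.

Lemma closed_box a b : closed (box a b).
Proof.
have -> : box a b =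
    \bigcap_i ([set p | a ord0 i <= p ord0 i] `&` [set p | p ord0 i <= b ord0 i]).
  apply/seteqP; split=> p /= h i; first by move=> _; apply/andP.
  by apply/andP; have [] := h i I.
apply: closed_bigI => i _; apply: closedI.
  by apply: closed_sub_ge; exact: coord_continuous.
by apply: closed_sub_le; exact: coord_continuous.
Qed.

Lemma closed_box_boundary a b : closed (box_boundary a b).
Proof.
have -> : box_boundary a b = \bigcup_(i in [set` [pred i | a ord0 i < b ord0 i]])
    (box a b `&` ([set p | p ord0 i = a ord0 i] `|`
                  [set p | p ord0 i = b ord0 i])).
  apply/seteqP; split=> p /=; first by move=> [bp [i [ab pi]]]; exists i.
  by move=> [i ab [bp pi]]; split => //; exists i.
apply: closed_bigcup; first exact: finite_finset.
move=> i _; apply: closedI; first exact: closed_box.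
by apply: closedU; apply: closed_sub_eq; exact: coord_continuous.
Qed.

End Boxes.

Lemma enum_coordinates (N m : nat) (D : {pred 'I_N}) : #|D| = m.+1 ->
  exists (e : 'I_m.+1 -> 'I_N) (g : 'I_N -> 'I_m.+1),
    [/\ forall j, e j \in D, cancel e g & {in D, cancel g e}].
Proof.
move=> Dm; have /card_gt0P[i0 Di0] : (0 < #|D|)%N by rewrite Dm.
exists (fun j => enum_val (cast_ord (esym Dm) j)).
exists (fun i => cast_ord Dm (enum_rank_in Di0 i)); split.
- by move=> j; exact: enum_valP.
- by move=> j; rewrite enum_valK_in cast_ordKV.
- by move=> i Di; rewrite cast_ordK enum_rankK_in.
Qed.

(** The affine coordinates along the nondegenerate directions of the box, of
    which there are at most n + 1, reduce this to the previous filling lemma. *)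
Lemma box_filling (R : realType) (n N : nat) (X : topologicalType)
    (V U : set X) (VU : V `<=` U) (y : X) (a b : 'rV[R]_N)
    (phi : 'rV[R]_N -> X) :
  (forall k, (k <= n)%N -> forall v,
     @induced_map_trivial R k _ _ (inclusion VU) v) ->
  (N <= n.+1)%N -> V y -> (forall i, a ord0 i <= b ord0 i) ->
  {within box_boundary a b, continuous phi} ->
  (forall p, box_boundary a b p -> V (phi p)) ->
  exists Phi : 'rV[R]_N -> X,
    [/\ {within box a b, continuous Phi},
        forall p, box_boundary a b p -> Phi p = phi p &
        forall p, box a b p -> U (Phi p)].
Proof.
move=> triv Nn Vy ab cphi Vphi.
pose D := [pred i | a ord0 i < b ord0 i].
have : (#|D| <= n.+1)%N by rewrite (leq_trans (max_card D))// card_ord.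
case Dm : #|D| => [|m]; last rewrite ltnS => mn.
  move=> _; have noD i : ~ (a ord0 i < b ord0 i).
    by move=> abi; have := card0_eq Dm i; rewrite !inE abi.
  exists (cst y); split; first by apply: continuous_subspaceT; exact: cst_continuous.
    by move=> p [_ [i [/noD]]].
  by move=> p _; exact: (VU _ Vy).
have [e [g [eD ge eg]]] := enum_coordinates Dm.
(* In a degenerate direction i the factor b_i - a_i vanishes and this is the
   constant a_i, whatever the index g i is. *)
pose alpha (q : 'rV[R]_m.+1) : 'rV[R]_N := \row_i
  (a ord0 i + (b ord0 i - a ord0 i) * ((1 + q ord0 (g i)) / 2)).
pose beta (p : 'rV[R]_N) : 'rV[R]_m.+1 := \row_j
  (2 * ((p ord0 (e j) - a ord0 (e j)) / (b ord0 (e j) - a ord0 (e j))) - 1).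
have calpha : continuous alpha.
  apply: continuous_row => i; under eq_fun do rewrite mxE.
  apply: continuous_add; first exact: cst_continuous.
  apply: continuous_mul; first exact: cst_continuous.
  apply: continuous_mul; last exact: cst_continuous.
  by apply: continuous_add; [exact: cst_continuous|exact: coord_continuous].
have cbeta : continuous beta.
  apply: continuous_row => i; under eq_fun do rewrite mxE.
  apply: continuous_sub; last exact: cst_continuous.
  apply: continuous_mul; first exact: cst_continuous.
  apply: continuous_mul; last exact: cst_continuous.
  by apply: continuous_sub; [exact: coord_continuous|exact: cst_continuous].
have D_gt0 j : 0 < b ord0 (e j) - a ord0 (e j) by rewrite subr_gt0; exact: eD.
have alpha_box q : `|q| <= 1 -> box a b (alpha q).
  move=> q1 i; rewrite mxE; have /row_norm_le := q1 => /(_ ler01) /(_ (g i)).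
  have := ab i; rewrite ler_norml; move: (q _ _) (a _ _) (b _ _) => x s t st.
  by move=> /andP[? ?]; apply/andP; split; nra.
have alpha_bdry q : `|q| = 1 -> box_boundary a b (alpha q).
  move=> q1; split; first by apply: alpha_box; rewrite q1.
  have [|j] := row_norm_attained (p := q); first by rewrite q1 oner_eq0.
  rewrite q1 => qj; exists (e j); split; first exact: eD.
  rewrite mxE ge; have [s|s] := leP 0 (q ord0 j).
    by move: qj; rewrite ger0_norm// => ->; right; lra.
  move: qj; rewrite ltr0_norm// => qj.
  by rewrite (_ : q ord0 j = -1); [left; lra|lra].
have beta_disk p : box a b p -> `|beta p| <= 1.
  move=> bp; apply/row_norm_le => // j; rewrite mxE.
  have /andP[ap pb] := bp (e j); rewrite ler_norml.
  have r0 : 0 <= (p ord0 (e j) - a ord0 (e j)) / (b ord0 (e j) - a ord0 (e j)).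
    by apply: divr_ge0; [rewrite subr_ge0|exact: ltW].
  have r1 : (p ord0 (e j) - a ord0 (e j)) / (b ord0 (e j) - a ord0 (e j)) <= 1.
    by rewrite ler_pdivrMr// mul1r lerD2r.
  by apply/andP; split; lra.
have beta_sphere p : box_boundary a b p -> `|beta p| = 1.
  move=> [bp [i [abi pi]]]; apply/eqP; rewrite eq_le beta_disk//=.
  apply: le_trans (row_norm_ge _ (g i)); rewrite mxE eg//.
  case: pi => ->.
    by rewrite subrr mul0r mulr0 sub0r normrN1.
  rewrite divff ?subr_eq0 ?gt_eqF// (_ : 2 * 1 - 1 = 1 :> R) ?normr1//; lra.
have alphaK p : box a b p -> alpha (beta p) = p.
  move=> bp; apply/rowP => i; rewrite mxE.
  have [abi|abi] := ltP (a ord0 i) (b ord0 i).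
    rewrite mxE eg//.
    set r := (p ord0 i - a ord0 i) / (b ord0 i - a ord0 i).
    have -> : (1 + (2 * r - 1)) / 2 = r by lra.
    by rewrite /r mulrC divfK ?subr_eq0 ?gt_eqF// addrC subrK.
  have ba : b ord0 i = a ord0 i by apply/eqP; rewrite eq_le abi ab.
  have := bp i; rewrite ba subrr mul0r addr0 => pa.
  by apply/eqP; rewrite eq_le.
have [||F [cF Fphi UF]] := disk_filling (phi := phi \o alpha) (triv _ mn).
- apply: within_comp cphi; first exact: alpha_bdry.
  exact: continuous_subspaceT.
- by move=> q /alpha_bdry /Vphi.
exists (F \o beta); split.
- apply: within_comp cF; first exact: beta_disk.
  exact: continuous_subspaceT.
- move=> p dp /=; rewrite Fphi/=; last exact: beta_sphere.
  by rewrite alphaK//; exact: box_boundary_sub.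
- by move=> p bp; apply: UF; exact: beta_disk.
Qed.

(** * Controlled filling *)

Lemma compact_cube (R : realType) (n : nat) : compact (@cube R n).
Proof.
have := @rV_compact R n (fun=> `[0 : R, 1]%classic)
  (fun=> @segment_compact R 0 1).
by rewrite (_ : mkset _ = @cube R n).
Qed.

Definition subbox (R : realType) (N : nat) (a b : 'rV[R]_N) : Prop :=
  forall i, [/\ 0 <= a ord0 i, a ord0 i <= b ord0 i & b ord0 i <= 1].

(** The extension property with control by f that is proved first for small
    boxes and then for all of them. *)
Definition fills (R : realType) (N : nat) (X : pseudoMetricType R)
    (f : 'rV[R]_N -> X) (d e : R) (a b : 'rV[R]_N) : Prop :=
  forall phi : 'rV[R]_N -> X,
  {within box_boundary a b, continuous phi} ->
  (forall p, box_boundary a b p -> ball (f p) d (phi p)) ->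
  exists Phi : 'rV[R]_N -> X,
    [/\ {within box a b, continuous Phi},
        forall p, box_boundary a b p -> Phi p = phi p &
        forall p, box a b p -> ball (f p) e (Phi p)].

(** Near x, a small box is mapped by f close to f x, so local connectedness at
    f x applies to it; compactness of the cube gives one d for all boxes. *)
Lemma small_box_filling (R : realType) (n N : nat) (X : pseudoMetricType R)
    (f : 'rV[R]_N -> X) (e : R) :
  @locally_n_connected R n X -> (N <= n.+1)%N -> continuous f -> 0 < e ->
  exists2 d : R, 0 < d & forall a b, subbox a b ->
    (forall i, b ord0 i - a ord0 i <= d) -> fills f d e a b.
Proof.
move=> lnc Nn cf e0.
pose P (d : R) (a : 'rV[R]_N) := forall b, subbox a b ->
  (forall i, b ord0 i - a ord0 i <= d) -> fills f d e a b.
suff : \forall d \near 0^'+, @cube R N `<=` P d.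
  move=> nearP; near (0 : R)^'+ => d.
  have Pd : @cube R N `<=` P d by near: d.
  exists d => // a b ab wd; apply: Pd => // i.
  by have [a0 abi b1] := ab i; rewrite a0 (le_trans abi).
have /compact_near_coveringP cov := @compact_cube R N.
apply: cov => x _.
have e2 : 0 < e / 2 by rewrite divr_gt0.
have [V [VU [nV triv]]] := lnc _ _ (nbhsx_ballx (f x) _ e2).
have [r /= r0 rV] := (nbhs_ballP _ _).1 nV.
have m0 : 0 < Num.min (r / 2) (e / 2) by rewrite lt_min e2 divr_gt0.
have [h /= h0 hf] := (nbhs_ballP _ _).1 (cf x _ (nbhsx_ballx (f x) _ m0)).
near=> a d => /= b ab wd phi cphi dphi.
have near_x p : box a b p -> ball x h p.
  move=> bp; rewrite (splitr h); apply: (@ball_triangle _ _ a).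
    by near: a; apply: nbhsx_ballx; rewrite divr_gt0.
  split; first by rewrite divr_gt0.
  move=> i j; rewrite (ord1 i) /ball/=.
  have /andP[ap pb] := bp j; rewrite ler0_norm ?subr_le0// opprB.
  apply: le_lt_trans (_ : d < _); first by apply: le_trans (wd j); rewrite lerD2r.
  by near: d; apply: nbhs_right_lt; rewrite divr_gt0.
have fball p : box a b p -> ball (f x) (Num.min (r / 2) (e / 2)) (f p).
  by move=> /near_x /hf.
have abi i : a ord0 i <= b ord0 i by have [] := ab i.
have [|F [cF Fphi UF]] := box_filling triv Nn (nbhs_singleton nV) abi cphi.
  move=> p dp; apply: rV; rewrite (splitr r).
  apply: (@ball_triangle _ _ (f p)).
    by apply: le_ball (fball _ (box_boundary_sub dp)); rewrite ge_min lexx.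
  apply: le_ball (dphi _ dp); apply: ltW.
  by near: d; apply: nbhs_right_lt; rewrite divr_gt0.
exists F; split => // p bp; rewrite (splitr e).
apply: (@ball_triangle _ _ (f x)); last exact: UF.
by apply: ball_sym; apply: le_ball (fball _ bp); rewrite ge_min lexx orbT.
Unshelve. all: by end_near. Qed.

Section Bisection.
Context {R : realType} {N : nat} {X : pseudoMetricType R}.
Implicit Types (a b p : 'rV[R]_N) (f phi : 'rV[R]_N -> X).

Definition set_coord a (j : 'I_N) (s : R) : 'rV[R]_N :=
  \row_i (if i == j then s else a ord0 i).

Lemma set_coord_eq a j s : set_coord a j s ord0 j = s.
Proof. by rewrite mxE eqxx. Qed.

Lemma set_coord_neq a j s i : i != j -> set_coord a j s ord0 i = a ord0 i.
Proof. by move=> /negbTE ij; rewrite mxE ij. Qed.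

(** The part of the boundary that contains the boundary of every slice
    orthogonal to direction j. *)
Definition lateral a b (j : 'I_N) : set 'rV[R]_N :=
  [set p | box a b p /\ exists2 i, i != j & a ord0 i < b ord0 i /\
             (p ord0 i = a ord0 i \/ p ord0 i = b ord0 i)].

(** By induction on w, the box is bisected w times in direction j.  Extending
    the map over the middle slice turns the closeness d' on the boundary of the
    slice into the weaker closeness d on the slice.  The lateral part of
    each half lies in that of the whole box, where the map is unchanged; as d' is
    required only there, the loss of precision does not accumulate. *)
Lemma bisected_filling f (j : 'I_N) (d d' e : R) :
  0 <= d' -> d' <= d ->
  (forall a b, subbox a b ->
     (forall i : 'I_N, (j <= i)%N -> b ord0 i - a ord0 i <= d) ->
     fills f d e a b) ->
  (forall a b, subbox a b ->
     (forall i : 'I_N, (j <= i)%N -> b ord0 i - a ord0 i <= d') ->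
     fills f d' d a b) ->
  forall w a b phi, subbox a b ->
    b ord0 j - a ord0 j <= 2 ^+ w * d ->
    (forall i : 'I_N, (j < i)%N -> b ord0 i - a ord0 i <= d') ->
    {within box_boundary a b, continuous phi} ->
    (forall p, box_boundary a b p -> ball (f p) d (phi p)) ->
    (forall p, lateral a b j p -> ball (f p) d' (phi p)) ->
    exists Phi : 'rV[R]_N -> X,
      [/\ {within box a b, continuous Phi},
          forall p, box_boundary a b p -> Phi p = phi p &
          forall p, box a b p -> ball (f p) e (Phi p)].
Proof.
move=> d'0 d'd fill_thin fill_slice.
have thin a b phi : subbox a b -> b ord0 j - a ord0 j <= d ->
    (forall i : 'I_N, (j < i)%N -> b ord0 i - a ord0 i <= d') ->
    {within box_boundary a b, continuous phi} ->
    (forall p, box_boundary a b p -> ball (f p) d (phi p)) ->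
    exists Phi : 'rV[R]_N -> X,
      [/\ {within box a b, continuous Phi},
          forall p, box_boundary a b p -> Phi p = phi p &
          forall p, box a b p -> ball (f p) e (Phi p)].
  move=> ab wj wi; apply: fill_thin => // i.
  rewrite leq_eqVlt => /orP[/eqP/val_inj <- //|/wi] /le_trans; exact.
elim=> [|w IH] a b phi ab wj wi cphi dphi lphi.
  by apply: thin => //; rewrite expr0 mul1r in wj.
have [abj|baj] := ltP (a ord0 j) (b ord0 j); last first.
  by apply: thin => //; apply: le_trans (le_trans d'0 d'd); rewrite subr_le0.
pose s := (a ord0 j + b ord0 j) / 2.
have as_ : a ord0 j < s by rewrite /s; lra.
have sb : s < b ord0 j by rewrite /s; lra.
pose a' := set_coord a j s; pose b' := set_coord b j s.
have [a'j b'j] : a' ord0 j = s /\ b' ord0 j = s by rewrite !set_coord_eq.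
have a'i i : i != j -> a' ord0 i = a ord0 i by exact: set_coord_neq.
have b'i i : i != j -> b' ord0 i = b ord0 i by exact: set_coord_neq.
have [a0 abi b1] : [/\ forall i, 0 <= a ord0 i, forall i, a ord0 i <= b ord0 i
    & forall i, b ord0 i <= 1] by split=> i; have [] := ab i.
have sub_slice : subbox a' b'.
  move=> i; have [->|ij] := eqVneq i j; last by rewrite a'i// b'i.
  by rewrite a'j b'j lexx (le_trans (a0 j) (ltW as_)) (le_trans (ltW sb) (b1 j)).
have sub_left : subbox a b'.
  move=> i; have [->|ij] := eqVneq i j; last by rewrite b'i.
  by rewrite b'j a0 (ltW as_) (le_trans (ltW sb) (b1 j)).
have sub_right : subbox a' b.
  move=> i; have [->|ij] := eqVneq i j; last by rewrite a'i.
  by rewrite a'j b1 (ltW sb) (le_trans (a0 j) (ltW as_)).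
have box_left p : box a b' p <-> box a b p /\ p ord0 j <= s.
  split=> [bp|[bp ps] i].
    have ps : p ord0 j <= s by have := bp j; rewrite b'j => /andP[].
    split => // i; have [->|ij] := eqVneq i j.
      have /andP[-> _] := bp j.
      by rewrite (le_trans ps (ltW sb)).
    by have := bp i; rewrite b'i.
  have [->|ij] := eqVneq i j; last by rewrite b'i.
  by rewrite b'j ps andbT; have /andP[] := bp j.
have box_right p : box a' b p <-> box a b p /\ s <= p ord0 j.
  split=> [bp|[bp ps] i].
    have ps : s <= p ord0 j by have := bp j; rewrite a'j => /andP[].
    split => // i; have [->|ij] := eqVneq i j.
      have /andP[_ ->] := bp j.
      by rewrite (le_trans (ltW as_) ps).
    by have := bp i; rewrite a'i.
  have [->|ij] := eqVneq i j; last by rewrite a'i.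
  by rewrite a'j ps; have /andP[] := bp j.
have box_slice p : box a' b' p <-> box a b p /\ p ord0 j = s.
  split=> [bp|[bp ps] i].
    have ps : p ord0 j = s.
      by have := bp j; rewrite a'j b'j => h; apply/eqP; rewrite eq_le andbC.
    split => // i; have [->|ij] := eqVneq i j.
      by rewrite ps (ltW as_) (ltW sb).
    by have := bp i; rewrite a'i// b'i.
  have [->|ij] := eqVneq i j; last by rewrite a'i// b'i.
  by rewrite a'j b'j ps lexx.
have slice_lateral p : box_boundary a' b' p -> lateral a b j p.
  move=> [/box_slice[bp _] [i [abi' pi]]]; split => //.
  have ij : i != j.
    by apply: contraTneq abi' => ->; rewrite a'j b'j ltxx.
  by exists i => //; rewrite a'i// b'i// in abi' pi.
have lateral_bdry p : lateral a b j p -> box_boundary a b p.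
  by move=> [bp [i _ pi]]; split => //; exists i.
have slice_width (i : 'I_N) : (j <= i)%N -> b' ord0 i - a' ord0 i <= d'.
  rewrite leq_eqVlt => /orP[/eqP/val_inj <-|ji]; first by rewrite a'j b'j subrr.
  have ij : i != j by rewrite neq_ltn ji orbT.
  by rewrite a'i// b'i// wi.
have [||psi [cpsi psiE dpsi]] := fill_slice _ _ sub_slice slice_width phi.
- by apply: continuous_subspaceW cphi => p /slice_lateral /lateral_bdry.
- by move=> p /slice_lateral /lphi.
(* The same function extends phi on the boundaries of both halves. *)
pose phi' p := if p ord0 j == s then psi p else phi p.
have phi'_bdry p : box_boundary a b p -> phi' p = phi p.
  move=> [bp [i [abi' pi]]]; rewrite /phi'; case: eqP => // ps.
  apply: psiE; split; first by apply/box_slice.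
  have ij : i != j.
    by apply/eqP => ij; move: pi; rewrite ij ps => -[]; lra.
  by exists i; rewrite a'i// b'i.
have phi'_slice p : box a' b' p -> phi' p = psi p.
  by move=> /box_slice[_ ps]; rewrite /phi' ps eqxx.
have cphi' : {within box_boundary a b `|` box a' b', continuous phi'}.
  apply: withinU_continuous; [exact: closed_box_boundary|exact: closed_box| |].
    by apply: within_eq cphi => p /phi'_bdry.
  by apply: within_eq cpsi => p /phi'_slice.
have dphi' p : (box_boundary a b `|` box a' b') p -> ball (f p) d (phi' p).
  move=> [dp|bp]; first by rewrite phi'_bdry//; exact: dphi.
  by rewrite phi'_slice//; exact: dpsi.
have lphi' p : lateral a b j p -> ball (f p) d' (phi' p).
  by move=> lp; rewrite phi'_bdry; [exact: lphi|exact: lateral_bdry].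
have left_bdry : box_boundary a b' `<=` box_boundary a b `|` box a' b'.
  move=> p [/box_left[bp ps] [i [abi' pi]]].
  have [ij|ij] := eqVneq i j; last first.
    by left; split => //; exists i; rewrite b'i// in abi' pi.
  rewrite ij b'j in abi' pi; case: pi => pj.
    by left; split => //; exists j; split => //; left.
  by right; apply/box_slice.
have right_bdry : box_boundary a' b `<=` box_boundary a b `|` box a' b'.
  move=> p [/box_right[bp ps] [i [abi' pi]]].
  have [ij|ij] := eqVneq i j; last first.
    by left; split => //; exists i; rewrite a'i// in abi' pi.
  rewrite ij a'j in abi' pi; case: pi => pj.
    by right; apply/box_slice.
  by left; split => //; exists j; split => //; right.
have half_width : s - a ord0 j <= 2 ^+ w * d /\ b ord0 j - s <= 2 ^+ w * d.
  by move: wj; rewrite exprS /s; split; lra.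
have [|||||Phi1 [cPhi1 Phi1E dPhi1]] := IH a b' phi' sub_left.
- by rewrite b'j; have [] := half_width.
- move=> i ji; have ij : i != j by rewrite neq_ltn ji orbT.
  by rewrite b'i// wi.
- exact: continuous_subspaceW cphi'.
- by move=> p /left_bdry /dphi'.
- move=> p [/box_left[bp _] [i ij pi]]; apply: lphi'; split => //.
  by exists i => //; rewrite b'i// in pi.
have [|||||Phi2 [cPhi2 Phi2E dPhi2]] := IH a' b phi' sub_right.
- by rewrite a'j; have [] := half_width.
- move=> i ji; have ij : i != j by rewrite neq_ltn ji orbT.
  by rewrite a'i// wi.
- exact: continuous_subspaceW cphi'.
- by move=> p /right_bdry /dphi'.
- move=> p [/box_right[bp _] [i ij pi]]; apply: lphi'; split => //.
  by exists i => //; rewrite a'i// in pi.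
(* The two extensions agree on the slice, as both equal phi' there. *)
pose Phi p := if p ord0 j <= s then Phi1 p else Phi2 p.
have Phi_left p : box a b' p -> Phi p = Phi1 p.
  by move=> /box_left[_ ps]; rewrite /Phi ps.
have Phi_right p : box a' b p -> Phi p = Phi2 p.
  move=> /box_right[bp sp]; rewrite /Phi; case: ifPn => // ps.
  have pj : p ord0 j = s by apply/eqP; rewrite eq_le ps.
  rewrite Phi1E ?Phi2E//; split.
  - by apply/box_right.
  - by exists j; rewrite a'j; split=> //; left.
  - by apply/box_left.
  - by exists j; rewrite b'j; split=> //; right.
have box_halves : box a b = box a b' `|` box a' b.
  apply/seteqP; split=> p; last by case=> [/box_left[]|/box_right[]].
  have [ps bp|/ltW ps bp] := leP (p ord0 j) s; first by left; apply/box_left.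
  by right; apply/box_right.
exists Phi; split.
- rewrite box_halves; apply: withinU_continuous; try exact: closed_box.
    by apply: within_eq cPhi1 => p /Phi_left.
  by apply: within_eq cPhi2 => p /Phi_right.
- move=> p dp; rewrite -phi'_bdry//; have [bp [i [abi' pi]]] := dp.
  have [ps|/ltW ps] := leP (p ord0 j) s.
    have lp : box a b' p by apply/box_left.
    rewrite Phi_left// Phi1E//; split => //; exists i.
    have [ij|ij] := eqVneq i j; last by rewrite b'i.
    by rewrite ij b'j in pi *; split => //; case: pi => ?; [left|lra].
  have rp : box a' b p by apply/box_right.
  rewrite Phi_right// Phi2E//; split => //; exists i.
  have [ij|ij] := eqVneq i j; last by rewrite a'i.
  by rewrite ij a'j in pi *; split => //; case: pi => ?; [lra|right].
- move=> p; rewrite box_halves => -[bp|bp].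
    by rewrite Phi_left//; exact: dPhi1.
  by rewrite Phi_right//; exact: dPhi2.
Qed.

Lemma fills_mono f d d' e a b : d' <= d -> fills f d e a b -> fills f d' e a b.
Proof.
move=> d'd fl phi cphi dphi; apply: fl => // p /dphi; exact: le_ball.
Qed.

(** Induction on the number k of directions in which the width of the box is
    unrestricted, starting with small boxes for k = 0. *)
Lemma controlled_filling (n : nat) f (e : R) :
  @locally_n_connected R n X -> (N <= n.+1)%N -> continuous f -> 0 < e ->
  exists2 d, 0 < d & forall a b, subbox a b -> fills f d e a b.
Proof.
move=> lnc Nn cf e0.
suff step k : (k <= N)%N -> forall e, 0 < e -> exists2 d, 0 < d &
    forall a b, subbox a b ->
      (forall i : 'I_N, (k <= i)%N -> b ord0 i - a ord0 i <= d) -> fills f d e a b.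
  have [d d0 fd] := step N (leqnn N) e e0.
  by exists d => // a b ab; apply: fd => // i; rewrite leqNgt ltn_ord.
elim: k => [_|k IH kN] {}e {}e0.
  have [d d0 fd] := small_box_filling lnc Nn cf e0.
  by exists d => // a b ab wd; apply: fd => // i; exact: wd.
have [d d0 fd] := IH (ltnW kN) e e0.
(* d is the precision needed for filling the slabs, d2 the one needed for
   filling the slices to precision d. *)
have [d2 d20 fd2] := IH (ltnW kN) d d0.
have m0 : 0 < Num.min d d2 by rewrite lt_min d0.
exists (Num.min d d2) => // a b ab wd phi cphi dphi.
pose j := Ordinal kN.
have md : Num.min d d2 <= d by rewrite ge_min lexx.
have [w wE] : exists w, 1 <= 2 ^+ w * d.
  have [w wd'] : exists w, d^-1 < w%:R.
    by exists (Num.truncn d^-1).+1; rewrite truncnS_gt.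
  exists w; rewrite -ler_pdivrMr// mul1r; apply: le_trans (ltW wd') _.
  by rewrite -natrX ler_nat ltnW// ltn_expl.
apply: (@bisected_filling f j d (Num.min d d2) e (ltW m0) md _ _ w) => //.
- move=> a1 b1 ab1 wm; apply: (fills_mono (d := d2)).
    by rewrite ge_min lexx orbT.
  by apply: fd2 => // i /wm /le_trans; apply; rewrite ge_min lexx orbT.
- apply: le_trans wE; have [a0 _ b1] := ab j.
  by apply: le_trans b1; rewrite gerBl.
- by move=> p /dphi; exact: le_ball.
- by move=> p [bp [i _ pi]]; apply: dphi; split => //; exists i.
Qed.

End Bisection.

(** * Close maps are homotopic *)

Lemma box_cube (R : realType) (n : nat) : box 0 (const_mx 1) = @cube R n.
Proof.
by apply/seteqP; split=> p bp i; have := bp i; rewrite !mxE.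
Qed.

Lemma box_boundary_cube (R : realType) (n : nat) :
  box_boundary 0 (const_mx 1) = @cube_boundary R n.
Proof.
apply/seteqP; split=> p [bp [i]].
  by rewrite !mxE => -[_ pi]; split; [rewrite -box_cube|exists i].
by move=> pi; split; [rewrite box_cube|exists i; rewrite !mxE ltr01].
Qed.

Section HomotopyEquivalence.
Context {R : realType} {n : nat} {T : topologicalType} (x : T).
Implicit Types f g h : 'rV[R]_n -> T.

Lemma homotopic_sym f g : homotopic x f g -> homotopic x g f.
Proof.
move=> [H [cH H0 H1 Hd]]; exists (fun st => H (1 - st.1, st.2)); split => /=.
- apply: within_comp cH => [[s t] [/unit_itvP/andP[/= s0 s1] ct]|].
    by split => //; apply/unit_itvP; rewrite /= subr_ge0 s1 gerBl.
  apply/continuous_subspaceT/continuous_pair.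
    apply: continuous_sub; first exact: cst_continuous.
    by move=> st; exact: cvg_fst.
  by move=> st; exact: cvg_snd.
- by move=> t; rewrite subr0; exact: H1.
- by move=> t; rewrite subrr; exact: H0.
- by move=> s t /andP[s0 s1]; apply: Hd; rewrite subr_ge0 s1 gerBl.
Qed.

Lemma homotopic_trans f g h :
  homotopic x f g -> homotopic x g h -> homotopic x f h.
Proof.
move=> [H [cH H0 H1 Hd]] [K [cK K0 K1 Kd]].
pose J (st : R * 'rV[R]_n) := if st.1 <= 1 / 2 then H (2 * st.1, st.2)
                              else K (2 * st.1 - 1, st.2).
have c1 : continuous (fun st : R * 'rV[R]_n => st.1).
  by move=> st; exact: cvg_fst.
have c2 : continuous (fun st : R * 'rV[R]_n => st.2).
  by move=> st; exact: cvg_snd.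
have cc : closed ((fun st : R * 'rV[R]_n => st.2) @^-1` (@cube R n)).
  by apply: closed_preimage => //; rewrite -box_cube; exact: closed_box.
exists J; split.
- have -> : `[0, 1]%classic `*` @cube R n =
     ([set st : R * 'rV[R]_n | 0 <= st.1] `&` [set st | st.1 <= 1 / 2]
        `&` (snd @^-1` (@cube R n))) `|`
     ([set st : R * 'rV[R]_n | 1 / 2 <= st.1] `&` [set st | st.1 <= 1]
        `&` (snd @^-1` (@cube R n))).
    apply/seteqP; split=> -[s t].
      move=> [/unit_itvP/andP[/= s0 s1] ct]; have [|/ltW] := leP s (1 / 2); by [left|right].
    by move=> /= [] [[? ?] ?]; split => //; apply/unit_itvP/andP; split => /=; lra.
  apply: withinU_continuous.
  + by apply: closedI => //; apply: closedI; [exact: closed_sub_ge|exact: closed_sub_le].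
  + by apply: closedI => //; apply: closedI; [exact: closed_sub_ge|exact: closed_sub_le].
  + apply: (within_eq (f := H \o (fun st => (2 * st.1, st.2)))).
      by move=> [s t] /= [[_ s2] _]; rewrite /J /= s2.
    apply: within_comp cH.
      by move=> [s t] /= [[? ?] ?]; split => //=; apply/unit_itvP/andP; split; lra.
    apply/continuous_subspaceT/continuous_pair => //.
    by apply: continuous_mul => //; exact: cst_continuous.
  + apply: (within_eq (f := K \o (fun st => (2 * st.1 - 1, st.2)))).
      move=> [s t] /= [[s2 _] ct]; rewrite /J /=; case: ifPn => // s2'.
      have -> : s = 1 / 2 by apply/eqP; rewrite eq_le s2'.
      by rewrite (_ : 2 * (1 / 2) = 1 :> R) ?subrr ?K0 ?H1//; lra.
    apply: within_comp cK.
      by move=> [s t] /= [[? ?] ?]; split => //=; apply/unit_itvP/andP; split; lra.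
    apply/continuous_subspaceT/continuous_pair => //.
    apply: continuous_sub; last exact: cst_continuous.
    by apply: continuous_mul => //; exact: cst_continuous.
- by move=> t ct; rewrite /J /= mulr0 ifT ?H0//; lra.
- move=> t ct; rewrite /J /= ifF; last by apply/negbTE; rewrite -ltNge; lra.
  by rewrite mulr1 (_ : 2 - 1 = 1 :> R) ?K1//; lra.
- move=> s t /andP[s0 s1] dt; rewrite /J /=; case: ifPn => [s2|].
    by apply: Hd => //; apply/andP; split; lra.
  by rewrite -ltNge => s2; apply: Kd => //; apply/andP; split; lra.
Qed.

Lemma homotopy_class_eq f g :
  homotopic x f g -> homotopy_class x f = homotopy_class x g.
Proof.
move=> fg; apply/seteqP; split=> h /=; last exact: homotopic_trans.
by apply: homotopic_trans; exact: homotopic_sym.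
Qed.

End HomotopyEquivalence.

Definition clamp (R : realType) (n : nat) (t : 'rV[R]_n) : 'rV[R]_n :=
  \row_i Num.max 0 (1 - Num.max 0 (1 - t ord0 i)).

Lemma clamp_cube (R : realType) (n : nat) (t : 'rV[R]_n) : cube (clamp t).
Proof.
move=> i; rewrite mxE le_max lexx/= ge_max ler01/=.
by rewrite gerBl le_max lexx.
Qed.

Lemma clamp_id (R : realType) (n : nat) (t : 'rV[R]_n) : cube t -> clamp t = t.
Proof.
move=> ct; apply/rowP => i; rewrite mxE; have /andP[t0 t1] := ct i.
by rewrite [Num.max 0 (1 - t _ _)]max_r ?subr_ge0// subKr max_r.
Qed.

Lemma continuous_clamp (R : realType) (n : nat) : continuous (@clamp R n).
Proof.
apply: continuous_row => i; under eq_fun do rewrite mxE.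
apply: continuous_maxr; first exact: cst_continuous.
apply: continuous_sub; first exact: cst_continuous.
apply: continuous_maxr; first exact: cst_continuous.
by apply: continuous_sub; [exact: cst_continuous|exact: coord_continuous].
Qed.

(** The homotopy is an extension over I x I^n, controlled by the constant
    homotopy F of f, of the map given by f on the bottom, g on the top and x on
    the sides; it is close to F as g is close to f and f is x on dI^n. *)
Lemma close_homotopic (R : realType) (n : nat) (X : pseudoMetricType R) (x : X)
    (f : 'rV[R]_n -> X) :
  @locally_n_connected R n X -> sphere_map x f ->
  exists2 d, 0 < d & forall g, sphere_map x g ->
    (forall t, cube t -> ball (f t) d (g t)) -> homotopic x f g.
Proof.
move=> lnc [cf fx].
(* The clamp makes F continuous on the whole of R^(n+1). *)
pose F := f \o (@clamp R n \o @tail_row R n).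
have cF : continuous F.
  apply/continuous_subspace_setT.
  apply: (within_comp (B := @cube R n)) cf.
    by move=> p _; exact: clamp_cube.
  apply: continuous_subspaceT => p; apply: continuous_comp.
    exact: continuous_tail_row.
  exact: continuous_clamp.
have [d d0 fill] := controlled_filling lnc (leqnn n.+1) cF ltr01.
exists d => // g [cg gx] fg.
pose I0 : 'rV[R]_n.+1 := 0; pose I1 : 'rV[R]_n.+1 := const_mx 1.
have subI : subbox I0 I1 by move=> i; rewrite !mxE ler01 !lexx.
pose phi (p : 'rV[R]_n.+1) := if p ord0 ord0 == 0 then f (tail_row p) else
  if p ord0 ord0 == 1 then g (tail_row p) else x.
have cube_tail p : box I0 I1 p -> cube (tail_row p).
  by rewrite box_cube => bp i; rewrite mxE; exact: bp.
pose bottom := box I0 I1 `&` [set p | p ord0 ord0 = 0].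
pose top := box I0 I1 `&` [set p | p ord0 ord0 = 1].
pose side := box I0 I1 `&` (@tail_row R n @^-1` @cube_boundary R n).
have bdryE p : box_boundary I0 I1 p -> (bottom `|` top `|` side) p.
  rewrite box_boundary_cube => -[cp [i pi]].
  have bp : box I0 I1 p by rewrite box_cube.
  move: pi; case: (unliftP ord0 i) => [j ->|->].
    move=> pj; right; split => //; split; first exact: cube_tail.
    by exists j; rewrite mxE.
  by case=> p0; left; [left|right].
have phi_bottom p : bottom p -> phi p = f (tail_row p).
  by move=> [_ p0]; rewrite /phi p0 eqxx.
have phi_top p : top p -> phi p = g (tail_row p).
  by move=> [_ p1]; rewrite /phi p1 oner_eq0 eqxx.
have phi_side p : side p -> phi p = x.
  by move=> [_ dp]; rewrite /phi fx// gx//; case: ifP => _ //; case: ifP.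
have [||Phi [cPhi PhiE _]] := fill _ _ subI phi.
- apply: (continuous_subspaceW (B := bottom `|` top `|` side)).
    by move=> p /bdryE.
  have closed_I := @closed_box R n.+1 I0 I1.
  have c0 := @coord_continuous R 1 n.+1 ord0 ord0.
  apply: withinU_continuous; [apply: closedU| |apply: withinU_continuous|].
  + by apply: closedI => //; exact: closed_sub_eq.
  + by apply: closedI => //; exact: closed_sub_eq.
  + apply: closedI => //; apply: closed_preimage; first exact: continuous_tail_row.
    by rewrite -box_boundary_cube; exact: closed_box_boundary.
  + by apply: closedI => //; exact: closed_sub_eq.
  + by apply: closedI => //; exact: closed_sub_eq.
  + apply: (within_eq (f := f \o @tail_row R n)) => [p /phi_bottom //|].
    apply: within_comp cf => [p [/cube_tail//]|].
    by apply: continuous_subspaceT; exact: continuous_tail_row.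
  + apply: (within_eq (f := g \o @tail_row R n)) => [p /phi_top //|].
    apply: within_comp cg => [p [/cube_tail//]|].
    by apply: continuous_subspaceT; exact: continuous_tail_row.
  + apply: (within_eq (f := cst x)) => [p /phi_side //|].
    by apply: continuous_subspaceT; exact: cst_continuous.
- move=> p dp; have ct := cube_tail _ (box_boundary_sub dp).
  rewrite /F /= clamp_id//.
  case: (bdryE _ dp) => [[/phi_bottom|/phi_top]|sp] => [->|->|].
  + exact: ballxx.
  + exact: fg.
  + rewrite phi_side// fx; last by case: sp.
    exact: ballxx.
have cons_box s t : 0 <= s <= 1 -> cube t -> box I0 I1 (cons_row s t).
  by move=> s01 ct; rewrite box_cube => i; rewrite mxE; case: unliftP.
exists (fun st => Phi (cons_row st.1 st.2)); split.
- apply: within_comp cPhi => [[s t] [/unit_itvP]|]; first exact: cons_box.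
  apply/continuous_subspaceT/continuous_row => i.
  case: (unliftP ord0 i) => [j ->|->].
    under eq_fun do rewrite cons_rowS.
    move=> st; apply: (@continuous_comp (R * 'rV[R]_n)%type _ _ snd
      (fun q : 'rV[R]_n => q ord0 j)); [exact: cvg_snd|exact: coord_continuous].
  by under eq_fun do rewrite cons_row0; move=> st; exact: cvg_fst.
- move=> t ct /=; have bt : bottom (cons_row 0 t).
    by split; [apply: cons_box => //; rewrite lexx ler01|rewrite /= cons_row0].
  rewrite PhiE ?phi_bottom ?cons_rowK//; split; first by case: bt.
  by exists ord0; rewrite !mxE unlift_none; split; [exact: ltr01|left].
- move=> t ct /=; have bt : top (cons_row 1 t).
    by split; [apply: cons_box => //; rewrite lexx ler01|rewrite /= cons_row0].
  rewrite PhiE ?phi_top ?cons_rowK//; split; first by case: bt.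
  by exists ord0; rewrite !mxE unlift_none; split; [exact: ltr01|right].
- move=> s t s01 [ct [j tj]] /=.
  have bst := cons_box _ _ s01 ct.
  rewrite PhiE.
    by apply: phi_side; split=> //; rewrite /= cons_rowK; split=> //; exists j.
  by split=> //; exists (lift ord0 j); rewrite cons_rowS !mxE; split=> //; exact: ltr01.
Qed.

(** * Countably many classes *)

Lemma uniform_continuity_cube (R : realType) (n : nat) (X : pseudoMetricType R)
    (f : 'rV[R]_n -> X) (e : R) :
  {within @cube R n, continuous f} -> 0 < e ->
  exists2 h : R, 0 < h & forall t t', cube t -> cube t' ->
    (forall i, `|t ord0 i - t' ord0 i| < h) -> ball (f t) e (f t').
Proof.
move=> /subspace_continuousP cf e0.
pose P (h : R) (t : 'rV[R]_n) := cube t -> forall t', cube t' ->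
  (forall i, `|t ord0 i - t' ord0 i| < h) -> ball (f t) e (f t').
suff : \forall h \near 0^'+, @cube R n `<=` P h.
  move=> nearP; near (0 : R)^'+ => h.
  have Ph : @cube R n `<=` P h by near: h.
  by exists h => // t t' ct; exact: Ph.
have /compact_near_coveringP cov := @compact_cube R n.
apply: cov => x cx.
have e2 : 0 < e / 2 by rewrite divr_gt0.
have [r /= r0 rf] := (nbhs_ballP _ _).1 (cf x cx _ (nbhsx_ballx (f x) _ e2)).
have r2 : 0 < r / 2 by rewrite divr_gt0.
near=> t h => /= ct t' ct' tt'.
have xt : ball x (r / 2) t by near: t; exact: nbhsx_ballx.
have tt : ball t (r / 2) t'.
  split=> // i j; rewrite (ord1 i); apply: lt_le_trans (tt' j) _.
  by near: h; apply: nbhs_right_le.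
rewrite (splitr e); apply: (@ball_triangle _ _ (f x)).
  apply/ball_sym/rf => //; apply: le_ball xt.
  by rewrite ler_pdivrMr// ler_peMr ?ltW// ltr1n.
by apply: rf => //; rewrite (splitr r); exact: ball_triangle tt.
Unshelve. all: by end_near. Qed.

(** For t in the cube the index is at most m + 1, a value reached only by
    t_i = 1; hence the m + 2 values for each coordinate. *)
Definition grid_cell (R : realType) (n m : nat) (t : 'rV[R]_n)
    : {ffun 'I_n -> 'I_m.+2} :=
  [ffun i => inord (Num.truncn (t ord0 i * m.+1%:R))].

Lemma grid_cell_close (R : realType) (n m : nat) (t t' : 'rV[R]_n) :
  cube t -> cube t' -> grid_cell m t = grid_cell m t' ->
  forall i, `|t ord0 i - t' ord0 i| < m.+1%:R^-1.
Proof.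
move=> ct ct' tt' i.
have trunc_le (s : R) : 0 <= s <= 1 -> (Num.truncn (s * m.+1%:R) < m.+2)%N.
  move=> /andP[s0 s1]; rewrite ltnS truncn_le_nat.
  by rewrite (le_lt_trans (y := m.+1%:R))// ?ltr_nat// ler_piMl.
have : Num.truncn (t ord0 i * m.+1%:R) = Num.truncn (t' ord0 i * m.+1%:R).
  have := congr1 (fun c : {ffun 'I_n -> 'I_m.+2} => val (c i)) tt'.
  by rewrite !ffunE /= !inordK// trunc_le.
have /andP[ti0 _] := ct i; have /andP[ti0' _] := ct' i.
have m0 : 0 < m.+1%:R :> R by rewrite ltr0n.
have /andP[] := @truncn_itv R (t ord0 i * m.+1%:R) (mulr_ge0 ti0 (ltW m0)).
have /andP[] := @truncn_itv R (t' ord0 i * m.+1%:R) (mulr_ge0 ti0' (ltW m0)).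
move: m0; set M : R := m.+1%:R => m0 l' u' + + e.
rewrite e -natr1 => l u; rewrite -natr1 in u'.
rewrite -(ltr_pM2r m0) mulVf ?gt_eqF// -{1}(gtr0_norm m0) -normrM mulrBl.
by rewrite ltr_norml; apply/andP; split; lra.
Qed.

(** A map f on the cube is encoded by a precision 1/(k+1), a mesh 1/(m+1) and a
    table with one point of the dense set for each cell of the grid, to which f
    is 1/(k+1)-close on that cell.  Two maps with the same code are
    2/(k+1)-close.  If k is so large that maps that close to f have the value
    cl f, the code determines the value, and there are countably many codes. *)
Lemma countable_locally_constant (R : realType) (n : nat)
    (X : pseudoMetricType R) (x : X) (C : Type)
    (A : set ('rV[R]_n -> X)) (cl : ('rV[R]_n -> X) -> C) :
  separable X ->
  (forall f, A f -> {within @cube R n, continuous f}) ->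
  (forall f, A f -> exists2 d, 0 < d & forall g, A g ->
     (forall t, cube t -> ball (f t) d (g t)) -> cl f = cl g) ->
  countable [set cl f | f in A].
Proof.
move=> [S /countable_injP[code code_inj] dS] cA locA.
pose point_of (k : nat) := xget x [set s | S s /\ code s = k].
have point_of_code s : S s -> point_of (code s) = s.
  move=> Ss; rewrite /point_of.
  case: xgetP => [s' -> [Ss' /code_inj]|/(_ s)[//]].
  by rewrite !inE; apply.
pose coded (k m : nat) (e : {ffun {ffun 'I_n -> 'I_m.+2} -> nat})
    (f : 'rV[R]_n -> X) :=
  forall t, cube t -> ball (point_of (e (grid_cell m t))) k.+1%:R^-1 (f t).
pose good (k m : nat) (f : 'rV[R]_n -> X) :=
  [/\ A f, exists e, @coded k m e f &
      forall g, A g -> (forall t, cube t ->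
        ball (f t) (k.+1%:R^-1 + k.+1%:R^-1) (g t)) -> cl f = cl g].
have -> : [set cl f | f in A] =
    \bigcup_(km in [set: nat * nat]) [set cl f | f in good km.1 km.2].
  apply/seteqP; split=> [c [f Af <-]|c [km _ [f [Af _ _] <-]]]; last by exists f.
  have [d d0 fd] := locA f Af.
  have [k kd] : exists k, k.+1%:R^-1 + k.+1%:R^-1 <= d.
    exists (Num.truncn (2 / d)).
    rewrite (_ : forall u : R, u + u = 2 * u); last by move=> u; lra.
    rewrite ler_pdivrMr ?ltr0n// mulrC -ler_pdivrMr//.
    by apply: ltW; exact: truncnS_gt.
  have k0 : 0 < k.+1%:R^-1 :> R by rewrite invr_gt0 ltr0n.
  have k2 : 0 < k.+1%:R^-1 / 2 :> R by rewrite divr_gt0.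
  have [h h0 fh] := uniform_continuity_cube (cA f Af) k2.
  have [m mh] : exists m, m.+1%:R^-1 <= h.
    exists (Num.truncn h^-1); rewrite -[leRHS]invrK lef_pV2 ?posrE ?invr_gt0//.
    by apply: ltW; exact: truncnS_gt.
  exists (k, m) => //; exists f => //; split => //; last first.
    move=> g Ag fg; apply: fd => // t ct; apply: le_ball kd _ _; exact: fg.
  have /choice[e eP] : forall c : {ffun 'I_n -> 'I_m.+2}, exists j, forall t,
      cube t -> grid_cell m t = c -> ball (point_of j) k.+1%:R^-1 (f t).
    move=> c0; have [[t0 [ct0 t0c]]|no_t] :=
        pselect (exists t : 'rV[R]_n, cube t /\ grid_cell m t = c0); last first.
      by exists 0%N => t ct tc; exfalso; apply: no_t; exists t.
    have [||s [sb Ss]] := dS (ball (f t0) (k.+1%:R^-1 / 2))°.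
    - by exists (f t0); exact: nbhsx_ballx.
    - exact: open_interior.
    exists (code s) => t ct tc; rewrite point_of_code// (splitr k.+1%:R^-1).
    apply: (@ball_triangle _ _ (f t0)).
      by apply: ball_sym; exact: interior_subset sb.
    apply: fh => // i; apply: lt_le_trans mh.
    by apply: grid_cell_close => //; rewrite t0c.
  by exists [ffun c => e c] => t ct; rewrite ffunE; exact: eP.
apply: bigcup_countable => [|[k m] _ /=]; first exact: countableP.
(* For fixed k and m, a value is sent to the table of one of the maps that take
   it, which is an injection into a countable type. *)
pose rep c := xget (cst x) [set f | good k m f /\ cl f = c].
pose tab c := xget [ffun=> 0%N] [set e | @coded k m e (rep c)].
have repP c : [set cl f | f in good k m] c -> good k m (rep c) /\ cl (rep c) = c.
  by move=> [f gf fc]; rewrite /rep; case: xgetP => [f' _ //|/(_ f)[]].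
have tabP c : [set cl f | f in good k m] c -> @coded k m (tab c) (rep c).
  move=> /repP[[_ [e ee] _] _]; rewrite /tab.
  by case: xgetP => [e' _ //|/(_ e)[]].
apply/countable_injP; exists (fun c => pickle (tab c)).
move=> c c' /[!inE] Cc Cc' /(pcan_inj pickleK) tt'.
have [[_ _ far] <-] := repP _ Cc; have [[Ag _ _] <-] := repP _ Cc'.
apply: far => // t ct; apply: (@ball_triangle _ _ (point_of (tab c (grid_cell m t)))).
  by apply: ball_sym; exact: tabP.
by rewrite tt'; exact: tabP.
Qed.

Theorem corollary3p9 (R : realType) (n : nat) (X : metricType R) (x : X) :
  (1 <= n)%N ->
  connected [set: X]%classic ->
  @locally_n_connected R n X ->
  separable X ->
  countable (@homotopy_group R n X x).
Proof.
move=> _ _ lnc sepX; apply: countable_locally_constant => //.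
  by move=> f [].
move=> f sf; have [d d0 fd] := close_homotopic lnc sf.
exists d => // g sg fg; apply: homotopy_class_eq; exact: fd.
Qed.
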